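(* There is a constant $0<c<1$ such that for all positive integers $m$ and $r$, \[ \deg_{\pm}(\mathrm{MP}_{m,r},12^{-m-1})\ge\min\{m,c\sqrt r\}. \]
   Context: $\mathrm{MP}_{m,r}\colon(\{0,1\}^r)^m\to\{0,1\}$ is $\mathrm{MP}_{m,r}(x)=\bigwedge_{i=1}^m\bigvee_{j=1}^rx_{i,j}$. For $f\colon X\to\{0,1\}$ on a finite $X\subset\mathbb{R}^N$ and $0\le\gamma\le1$, the $\gamma$-smooth threshold degree is $\deg_{\pm}(f,\gamma)=\max\operatorname{orth}((-1)^f\cdot\mu)$, the maximum over probability distributions $\mu$ on $X$ with $\mu(x)\ge\gamma/|X|$ for all $x\in X$, where $\operatorname{orth}\phi$ is the minimum total degree of a real polynomial $p$ with $\sum_{x\in X}\phi(x)p(x)\ne0$ ($\infty$ if none). *)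

(* Defs.v *)
From HB Require Import structures.
From mathcomp Require Import all_boot all_order all_algebra finmap.
From mathcomp Require Import boolp classical_sets reals ereal.
(* The notations of mpoly clash with those of MathComp-Analysis. *)
From mathcomp Require Import -(notations) mpoly.

Set Implicit Arguments.
Unset Strict Implicit.
Unset Printing Implicit Defensive.

Import Order.TTheory GRing.Theory Num.Theory.

Local Open Scope classical_set_scope.
Local Open Scope ring_scope.

Section Polynomials.
Variables (R : realType) (N : nat).

Definition peval (p : mpoly N R) (x : 'rV[R]_N) : R :=
  meval (fun i => x 0 i) p.

(* [mmeasure mdeg] is multinomials' [msize], i.e. 1 + total degree for p != 0. *)
Definition tdeg (p : mpoly N R) : nat := (mmeasure mdeg p).-1.

End Polynomials.

Section SmoothThresholdDegree.
Variables (R : realType) (N : nat) (X : {fset 'rV[R]_N}).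

Definition pairing (phi : X -> R) (p : mpoly N R) : R :=
  \sum_(x : X) phi x * peval p (val x).

(* The infimum of the empty set is +oo; otherwise it is a minimum, see
   [orth_min]. *)
Definition orth (phi : X -> R) : \bar R :=
  ereal_inf [set (tdeg p)%:R%:E | p in [set p | pairing phi p != 0]].

Definition smooth_distr (gamma : R) : set (X -> R) :=
  [set mu | [/\ forall x, 0 <= mu x, \sum_(x : X) mu x = 1
              & forall x, gamma / #|` X|%:R <= mu x]].

(* The supremum is a maximum as soon as a gamma-smooth distribution exists, see
   [smooth_thr_deg_max]. *)
Definition smooth_thr_deg (f : X -> bool) (gamma : R) : \bar R :=
  ereal_sup [set orth (fun x => (-1) ^+ f x * mu x) | mu in smooth_distr gamma].

Lemma orth_min (phi : X -> R) p0 : pairing phi p0 != 0 ->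
  exists2 p, pairing phi p != 0 &
    orth phi = (tdeg p)%:R%:E /\
    forall q, pairing phi q != 0 -> (tdeg p <= tdeg q)%N.
Proof.
move=> np0.
have ex : exists n, `[< exists2 p, pairing phi p != 0 & tdeg p = n >].
  by exists (tdeg p0); apply/asboolP; exists p0.
case: (ex_minnP ex) => _ /asboolP[p np <-] pmin; exists p => //.
have ple q : pairing phi q != 0 -> (tdeg p <= tdeg q)%N.
  by move=> nq; apply: pmin; apply/asboolP; exists q.
split=> //; apply/eqP; rewrite eq_le; apply/andP; split.
  by apply: ereal_inf_lbound; exists p.
by apply: le_ereal_inf_tmp => _ [q nq <-]; rewrite lee_fin ler_nat ple.
Qed.

Lemma peval_delta (x : X) :
  exists p, forall y : X, (peval p (val y) == 0) = (y != x).
Proof.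
have sep (y : X) : y != x ->
    exists i, (val x : 'rV[R]_N) 0 i != (val y : 'rV[R]_N) 0 i.
  move=> yx; apply/existsP; apply: contraNT yx; rewrite negb_exists => /forallP e.
  apply/eqP/val_inj/rowP => i.
  by have := e i; rewrite negbK => /eqP.
pose F (y : X) (q : mpoly N R) :=
  peval q (val y) = 0 /\ peval q (val x) != 0.
have exF (y : X) : exists q, y != x -> F y q.
  have [->|yx] := eqVneq y x; first by exists 0.
  have [i xyi] := sep y yx.
  exists (mpolyX R (mnm1 i) - mpolyC N ((val y : 'rV[R]_N) 0 i)).
  move=> _.
  by rewrite /F /peval !mevalB !mevalXU !mevalC subrr subr_eq0.
have [g gP] := choice exF.
exists (\prod_(y | y != x) g y) => y.
rewrite /peval rmorph_prod /= prodf_seq_eq0.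
have [->|yx] := eqVneq y x.
  apply/hasPn => z _ /=; apply/negP => /andP[zx]; apply/negP.
  by have [] := gP z zx.
apply/hasP; exists y; rewrite ?mem_index_enum //= yx /=.
by apply/eqP; have [] := gP y yx.
Qed.

Lemma smooth_thr_deg_max (f : X -> bool) (gamma : R) :
  smooth_distr gamma !=set0 ->
  exists2 mu, smooth_distr gamma mu &
    smooth_thr_deg f gamma = orth (fun x => (-1) ^+ f x * mu x) /\
    forall nu, smooth_distr gamma nu ->
      (orth (fun x => ((-1) ^+ f x * nu x)%R)
         <= orth (fun x => ((-1) ^+ f x * mu x)%R))%E.
Proof.
move=> [mu0 mu0P]; have [d dP] := choice peval_delta.
pose K := (\sum_(x : X) tdeg (d x))%N.
pose o (mu : X -> R) := orth (fun x => (-1) ^+ f x * mu x).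
have onat mu : smooth_distr gamma mu -> exists2 n, (n <= K)%N & o mu = n%:R%:E.
  move=> [mu_ge0 mu1 _].
  have [x mux] : exists x, mu x != 0.
    apply: contrapT => /forallNP mu_eq0.
    have : \sum_x mu x = 0.
      by apply: big1 => x _; apply/eqP/negPn/negP/mu_eq0.
    by rewrite mu1 => /eqP; rewrite oner_eq0.
  pose phi x := (-1) ^+ f x * mu x.
  have nz : pairing phi (d x) != 0.
    rewrite /pairing (bigD1 x) //= big1 ?addr0; last first.
      by move=> y yx; apply/eqP; rewrite mulf_eq0 dP yx orbT.
    by rewrite !mulf_eq0 signr_eq0 (negPf mux) dP eqxx.
  have [p np [oE ple]] := orth_min nz; exists (tdeg p) => //.
  by apply: leq_trans (ple _ nz) _; rewrite /K (bigD1 x) //= leq_addr.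
pose P n := `[< exists2 mu, smooth_distr gamma mu & o mu = n%:R%:E >].
have exP : exists n, P n.
  by have [n _ on] := onat _ mu0P; exists n; apply/asboolP; exists mu0.
have Pub n : P n -> (n <= K)%N.
  move=> /asboolP[mu /onat[k kK ->] /(congr1 fine) /= /eqP].
  by rewrite eqr_nat => /eqP <-.
case: (ex_maxnP exP Pub) => n /asboolP[mu muP on] nmax.
have omax nu : smooth_distr gamma nu -> (o nu <= o mu)%E.
  move=> nuP; have [k _ ok] := onat _ nuP.
  by rewrite on ok lee_fin ler_nat; apply: nmax; apply/asboolP; exists nu.
exists mu => //; split=> //; apply/eqP; rewrite eq_le; apply/andP; split.
  by apply: ge_ereal_sup => _ [nu nuP <-]; exact: omax.
by apply: ereal_sup_ubound; exists mu.
Qed.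

End SmoothThresholdDegree.

Section MinskyPapert.
Variable R : realType.

Definition cube (N : nat) : {fset 'rV[R]_N} :=
  [fset map_mx (fun b : bool => b%:R) v | v in 'rV[bool]_N]%fset.

(* x_{i,j} is the coordinate [mxvec_index i j] of x in {0,1}^(m * r). *)
Definition MP (m r : nat) (x : cube (m * r)) : bool :=
  [forall i : 'I_m, exists j : 'I_r,
     (val x : 'rV[R]_(m * r)) 0 (mxvec_index i j) == 1].

End MinskyPapert.

(* Main.v *)
(* A block distribution l0 puts mass > 1/2 on the zero block; l1 lives on nonzero
   blocks and has the same moments as l0 up to degree k ~ sqrt r / 3. On m blocks
   consider
     Phi = l1^{(x)m} - l0^{(x)m} + n^{(x)m}     ([mp_dual]),
   where n ([l0_balanced]) agrees with l0 off the zero block and has total mass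
   0. The first two terms cancel against a monomial of degree <= k, because each
   block then sees degree <= k; the third is killed by a monomial of degree < m,
   because some block then sees a constant. On inputs without a zero block the
   last two terms cancel, leaving l1^{(x)m} > 0; on the others the first term
   vanishes and the second dominates the third. So |Phi| / 2 is the required
   distribution.

   The pair l0, l1 comes from the positive and negative parts of the divided
   difference at the nodes 0, 1, 9, 36, ..., 9 k^2, spread uniformly over the
   layers of the cube of these Hamming weights; mixing in the uniform
   distribution on nonzero blocks with weight 1/12 makes both smooth. *)
Require Import Defs.
From mathcomp Require Import all_boot all_order all_algebra qpoly finmap.
From mathcomp Require Import zify ring lra.
Set Implicit Arguments.
Unset Strict Implicit.
Unset Printing Implicit Defensive.
Import Order.TTheory GRing.Theory Num.Theory.
Local Open Scope ring_scope.

(** * Divided differences *)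

(** Compare coefficients of degree [n] in Lagrange interpolation at [n + 1] nodes: that of [p] is 0,
    and each basis polynomial has the inverse of its node product as leading coefficient. *)
Lemma sum_lagrange_weights (K : fieldType) (x : nat -> K) n (p : {poly K}) :
  injective x -> (size p <= n)%N ->
  \sum_(i < n.+1) p.[x i] / \prod_(j < n.+1 | j != i) (x i - x j) = 0.
Proof.
move=> xI sp.
have /(congr1 (fun q : {poly K} => q`_n)) :=
  lagrange_gen (ltn0Sn n) xI (leqW sp).
rewrite (nth_default _ sp) coef_sum => E; rewrite [RHS]E; apply: eq_bigr => i _.
rewrite coefCM (lagrangeE (ltn0Sn n) xI) /= coefCM horner_prod; congr (_ * _).
set q := \prod_(j < n.+1 | j != i) ('X - (x j)%:P).
have qmon : q \is monic by apply: monic_prod => j _; apply: monicXsubC.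
have sq : size q = n.+1.
  rewrite /q -big_filter size_prod_XsubC -/(enum _) -cardE cardC1 card_ord //.
have -> : q`_n = 1.
  by move/monicP: qmon; rewrite lead_coefE sq.
rewrite mulr1; congr (_^-1).
by apply: eq_bigr => j _; rewrite hornerXsubC.
Qed.

(** Node 1 makes the weights at the later nodes decay quadratically relative to node 0; the factor 9
    keeps the sum of these ratios at most 1/2. *)
Definition node (i : nat) : nat := if i is j.+2 then 9 * j.+1 ^ 2 else i.

Lemma node_inj : injective node.
Proof. by move=> [|[|i]] [|[|j]] //=; nia. Qed.

(** Each step from [j] to [j + 1] trades the factor [k - j] for the larger [k + j + 1]. *)
Lemma fact_sqr_le k j : (j <= k)%N -> (k`! ^ 2 <= (k + j)`! * (k - j)`!)%N.
Proof.
elim: j => [|j IHj] jk; first by rewrite addn0 subn0 mulnn.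
apply: (leq_trans (IHj (ltnW jk))).
rewrite addnS factS -(subnSK jk) factS.
rewrite mulnCA mulnA leq_mul2r mulnC; apply/orP; right.
by rewrite mulnC leq_mul2r; apply/orP; right; lia.
Qed.

Section DualWeights.
Variable R : realFieldType.
Implicit Types (j k : nat).

(** Here [l != j] holds throughout; the case [k = j] starts the induction of [prod_sqr_dist]. *)
Lemma prod_sqr_dist_small j k : (k <= j)%N ->
  \prod_(0 <= l < k | l != j) `|j.+1%:R ^+ 2 - l.+1%:R ^+ 2 : R|
    * j.+1%:R * (j - k)`!%:R = (j + k).+1`!%:R.
Proof.
elim: k => [|k IHk] kj.
  by rewrite big_geq // mul1r subn0 addn0 factS natrM.
rewrite big_mkcond big_nat_recr //= -big_mkcond /=.
rewrite neq_ltn kj addnS factS natrM -(IHk (ltnW kj)) -(subnSK kj) factS.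
have -> : `|j.+1%:R ^+ 2 - k.+1%:R ^+ 2 : R| = (j + k).+2%:R * (j - k.+1).+1%:R.
  have -> : j = (j - k.+1 + k.+1)%N by rewrite subnK.
  move: (j - k.+1)%N => d; rewrite addnK.
  have -> : (d + k.+1).+1%:R ^+ 2 - k.+1%:R ^+ 2
     = (d + k.+1 + k).+2%:R * d.+1%:R :> R by rewrite -!natr1 !natrD; ring.
  by rewrite ger0_norm // mulr_ge0.
by rewrite natrM /=; ring.
Qed.

(** Each distance is [|j - l| * (j + l + 2)], so the product is built from factorials; [2 * (j + 1)]
    restores the sum skipped at [l = j], and the other [j + 1] turns [j!] into [(j + 1)!]. *)
Lemma prod_sqr_dist j k : (j < k)%N ->
  \prod_(0 <= l < k | l != j) `|j.+1%:R ^+ 2 - l.+1%:R ^+ 2 : R|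
    * (2 * j.+1%:R ^+ 2) = (k + j.+1)`!%:R * (k - j.+1)`!%:R.
Proof.
elim: k => // k IHk; rewrite ltnS leq_eqVlt => /predU1P[->|jk].
  rewrite big_mkcond big_nat_recr //= -big_mkcond /= eqxx mulr1 subnn fact0.
  have := prod_sqr_dist_small (leqnn k); rewrite subnn fact0 mulr1 => E.
  rewrite mulr1 addSn factS natrM addnS -E -!natr1 !natrD; ring.
rewrite big_mkcond big_nat_recr //= -big_mkcond /= neq_ltn jk orbT.
rewrite addSn subSS -(subnSK jk) !factS !natrM.
rewrite mulrAC IHk //.
have -> : `|j.+1%:R ^+ 2 - k.+1%:R ^+ 2 : R| =
    (k + j.+1).+1%:R * (k - j.+1).+1%:R.
  have -> : k = (k - j.+1 + j.+1)%N by rewrite subnK.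
  move: (k - j.+1)%N => d; rewrite addnK distrC.
  have -> : (d + j.+1).+1%:R ^+ 2 - j.+1%:R ^+ 2
     = (d + j.+1 + j.+1).+1%:R * d.+1%:R :> R by rewrite -!natr1 !natrD; ring.
  by rewrite ger0_norm // mulr_ge0.
by rewrite /=; ring.
Qed.

Lemma prod_sqr_le j k : (j < k)%N ->
  \prod_(0 <= l < k | l != j) l.+1%:R ^+ 2
   <= 2 * \prod_(0 <= l < k | l != j) `|j.+1%:R ^+ 2 - l.+1%:R ^+ 2 : R|.
Proof.
move=> jk; have j2 : 0 < j.+1%:R ^+ 2 :> R by rewrite exprn_gt0 // ltr0n.
rewrite -(ler_pM2r j2) mulrAC [_ * _ * \prod_(_ <= _ < _ | _) _]mulrC.
rewrite prod_sqr_dist //.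
have -> : \prod_(0 <= l < k | l != j) l.+1%:R ^+ 2 * j.+1%:R ^+ 2
    = (k`! ^ 2)%:R :> R.
  rewrite natrX fact_prod natr_prod big_add1 /= -prodrXl.
  rewrite big_mkord [in RHS]big_mkord [RHS](bigD1 (Ordinal jk)) //= mulrC.
  by congr (_ * _); apply: eq_bigl => l.
by rewrite -natrM ler_nat fact_sqr_le.
Qed.

Lemma prod_split_node k i (F : nat -> R) :
  \prod_(0 <= l < k.+2 | l != i) F l =
  (if 0 != i then F 0 else 1) * (if 1 != i then F 1 else 1)
   * \prod_(0 <= l < k | l.+2 != i) F l.+2.
Proof.
rewrite big_mkcond big_mkord !big_ord_recl /= mulrA; congr (_ * _).
by rewrite big_mkord [RHS]big_mkcond.
Qed.

(** Its inverse is the weight of node [i] in the divided difference of order [k + 1]. *)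
Definition node_prod k i : R :=
  \prod_(0 <= l < k.+2 | l != i) ((node i)%:R - (node l)%:R).

Lemma node_prod_neq0 k i : node_prod k i != 0.
Proof.
rewrite /node_prod big_mkord; apply/prodf_neq0 => l li.
rewrite subr_eq0 eqr_nat.
by apply: contra li => /eqP/node_inj ->.
Qed.

(** The distances to the later nodes are negative from both 0 and 1, so only the pair 0, 1
    contributes a sign. Node 1 therefore adds nothing to the positive part of the weights. *)
Lemma node_prod1_le0 k : node_prod k 0 / node_prod k 1 <= 0.
Proof.
rewrite /node_prod !prod_split_node /= !mul1r mulr1 !subr0 sub0r mul1r.
rewrite -mulrA mulN1r oppr_le0 -prodf_div.
apply: prodr_ge0 => l _; rewrite mulr_le0 // ?oppr_le0 ?sub0r ?ler0n //.
  by rewrite oppr_le0 ler0n.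
by rewrite invr_le0 subr_le0 ler1n muln_gt0.
Qed.

(** The distance from 0 to [9 * (j + 1)^2] occurs in both products and cancels; the distance to node
    1 gives the denominator, and [prod_sqr_le] bounds the rest by 2. *)
Lemma node_prod_ratio j k : (j < k)%N ->
  `|node_prod k 0 / node_prod k j.+2| <= 2 / (9 * j.+1%:R ^+ 2 - 1).
Proof.
move=> jk; have j1 : 1 <= j.+1%:R ^+ 2 :> R by rewrite exprn_ege1 // ler1n.
rewrite /node_prod !prod_split_node /= mul1r subr0 sub0r.
rewrite normf_div !normrM normrN1 mul1r !normr_prod.
have n9 (a b : R) : `|9 * a - 9 * b| = 9 * `|a - b|.
  by rewrite -mulrBr normrM (ger0_norm (ler0n _ _)).
have -> : \prod_(0 <= l < k) `|0 - (9 * l.+1 ^ 2)%:R : R| =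
   9 * j.+1%:R ^+ 2 * (\prod_(0 <= l < k | l != j) 9
      * \prod_(0 <= l < k | l != j) l.+1%:R ^+ 2).
  rewrite -big_split /= !big_mkord (bigD1 (Ordinal jk)) //= sub0r normrN.
  rewrite ger0_norm ?ler0n // natrM natrX; congr (_ * _).
  apply: eq_big => // l _.
  by rewrite sub0r normrN ger0_norm ?ler0n // natrM natrX.
have -> : \prod_(0 <= l < k | l.+2 != j.+2)
      `|(9 * j.+1 ^ 2)%:R - (9 * l.+1 ^ 2)%:R : R| =
   \prod_(0 <= l < k | l != j) 9
      * \prod_(0 <= l < k | l != j) `|j.+1%:R ^+ 2 - l.+1%:R ^+ 2 : R|.
  rewrite -big_split /=; apply: eq_bigr => l _.
  by rewrite (natrM _ 9) (natrM _ 9) !natrX n9.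
have := prod_sqr_le jk; rewrite natrM natrX.
have := prod_sqr_dist jk.
set P := \prod_(_ <= _ < _ | _) `|_|; set Q := \prod_(_ <= _ < _ | _) _ ^+ 2.
set N := \prod_(_ <= _ < _ | _) 9.
have N0 : 0 < N by rewrite /N big_mkord; apply: prodr_gt0.
move: (j.+1%:R ^+ 2) j1 => a a1 PE QP.
have P0 : 0 < P.
  have : 0 < P * (2 * a) by rewrite PE -natrM ltr0n muln_gt0 !fact_gt0.
  by rewrite pmulr_lgt0 //; lra.
rewrite !ger0_norm; [| lra ..].
rewrite ler_pdivrMr; last by rewrite !mulr_gt0 //; lra.
have -> : 2 / (9 * a - 1) * (9 * a * (9 * a - 1) * (N * P)) =
    9 * a * (N * (2 * P)) by field; lra.
by rewrite ler_pM2l ?ler_pM2l //; lra.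
Qed.

Lemma sum_node_bound k :
  \sum_(j < k) 2 / (9 * j.+1%:R ^+ 2 - 1) <= 2^-1 :> R.
Proof.
(* A telescoping strengthening for the induction, with equality at [k = 1]. *)
suff : \sum_(j < k) 2 / (9 * j.+1%:R ^+ 2 - 1) <= 2^-1 * (1 - k.+1%:R^-1) :> R.
  have : 0 <= k.+1%:R^-1 :> R by rewrite invr_ge0 ler0n.
  by move: (k.+1%:R^-1) => t; lra.
elim: k => [|k IHk]; first by rewrite big_ord0 invr1 subrr mulr0.
rewrite big_ord_recr /=; apply: (le_trans (lerD IHk (lexx _))).
have a1 : 1 <= k.+1%:R :> R by rewrite ler1n.
rewrite -[k.+2%:R]natr1; move: (k.+1%:R : R) a1 => a a1.
rewrite -subr_ge0.
have -> : 2^-1 * (1 - (a + 1)^-1) - (2^-1 * (1 - a^-1) + 2 / (9 * a ^+ 2 - 1))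
  = (5 * a + 1) * (a - 1) / (2 * a * (a + 1) * (9 * a ^+ 2 - 1)).
  by field; rewrite !gt_eqF //=; nra.
by rewrite divr_ge0 ?mulr_ge0 //; nra.
Qed.

(** Scale the divided difference to weight 1 at node 0. The other positive weights sum to at most
    1/2, so after normalising the positive part node 0 keeps at least 2/3. *)
Lemma or_dual_weights k : exists a b : 'I_k.+2 -> R,
  [/\ forall i, (0 <= a i) && (0 <= b i), \sum_i a i = 1,
      2 / 3 <= a ord0, b ord0 = 0 &
      forall p : {poly R}, (size p <= k.+1)%N ->
        \sum_i a i * p.[(node i)%:R] = \sum_i b i * p.[(node i)%:R]].
Proof.
pose v (i : 'I_k.+2) := node_prod k 0 / node_prod k i.
pose L := \sum_i Num.max (v i) 0.
have v0 : v ord0 = 1 by rewrite /v divff // node_prod_neq0.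
have L1 : 1 <= L.
  rewrite /L big_ord_recl v0 (_ : Num.max 1 0 = 1) ?lerDl.
    by apply: sumr_ge0 => i _; rewrite le_max lexx orbT.
  by apply/max_idPl; apply: ler01.
have L2 : L <= 3 / 2.
  rewrite /L !big_ord_recl v0 (_ : Num.max 1 0 = 1); last first.
    by apply/max_idPl; apply: ler01.
  rewrite (_ : Num.max _ 0 = 0); last by apply/max_idPr/node_prod1_le0.
  rewrite add0r (_ : 3 / 2 = 1 + 2^-1); last by field.
  rewrite lerD2l; apply: le_trans (sum_node_bound k); apply: ler_sum => j _.
  have := node_prod_ratio (ltn_ord j); apply: le_trans.
  by rewrite ge_max normr_ge0 ler_norm.
have Lgt0 : 0 < L by lra.
exists (fun i => Num.max (v i) 0 / L), (fun i => Num.max (- v i) 0 / L); split.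
- by move=> i; rewrite !divr_ge0 ?le_max ?lexx ?orbT //; lra.
- by rewrite -mulr_suml divff // gt_eqF.
- rewrite v0 (_ : Num.max 1 0 = 1); last by apply/max_idPl; apply: ler01.
  by rewrite ler_pdivlMr //; lra.
- by rewrite v0 (_ : Num.max (-1) 0 = 0) ?mul0r //; apply/max_idPr; lra.
- move=> p sp; apply/eqP; rewrite -subr_eq0 -sumrB; apply/eqP.
  have nI : injective (fun i => (node i)%:R : R).
    by move=> i j /eqP; rewrite eqr_nat => /eqP/node_inj.
  have := sum_lagrange_weights nI sp.
  move=> /(congr1 (fun t => node_prod k 0 / L * t)); rewrite mulr0 => E.
  rewrite -[RHS]E mulr_sumr; apply: eq_bigr => i _.
  rewrite -mulrBl.
  have -> : Num.max (v i) 0 / L - Num.max (- v i) 0 / L = v i / L.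
    rewrite -mulrBl; congr (_ / _).
    by rewrite /Num.max; case: ltP => ?; case: ltP => ?; lra.
  rewrite /v /node_prod [in \prod_(_ <= _ < _ | _ != nat_of_ord i) _]big_mkord.
  ring.
Qed.

End DualWeights.

(** * Symmetrization on a block *)

(** Both sides count the [k]-subsets of an [n]-set with an ordered choice of [b] distinct elements
    in them. *)
Lemma bin_ffact_sub (n k b : nat) : (b <= k <= n)%N ->
  ('C(n, k) * k ^_ b = n ^_ b * 'C(n - b, k - b))%N.
Proof.
case/andP=> bk kn; have bn := leq_trans bk kn.
apply/eqP; rewrite -(eqn_pmul2r (fact_gt0 (k - b))).
rewrite -(eqn_pmul2r (fact_gt0 (n - k))).
have := bin_fact kn; have := ffact_fact bk; have := ffact_fact bn.
have := bin_fact (leq_sub2r b kn).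
rewrite subnBA // subnK // => E1 E2 E3 E4.
apply/eqP; move: E2 E4; rewrite -E1 -E3 => <-; nia.
Qed.

Lemma card_supset_draws (T : finType) (B : {set T}) k : (#|B| <= k)%N ->
  #|[set A : {set T} | (B \subset A) && (#|A| == k)]| =
  'C(#|T| - #|B|, k - #|B|).
Proof.
move=> Bk.
have -> : (#|T| - #|B|)%N = #|~: B| by rewrite [RHS]cardsCs setCK.
rewrite -cards_draws.
rewrite -(card_in_imset (f := fun A : {set T} => A :\: B)); last first.
  have K (A : {set T}) : B \subset A -> (A :\: B) :|: B = A.
    move=> /setUidPl BA.
    by rewrite setDE setUIl [~: B :|: B]setUC setUCr setIT.
  move=> A1 A2; rewrite !inE => /andP[d1 _] /andP[d2 _] E.
  by rewrite -(K _ d1) -(K _ d2) E.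
apply: eq_card => A; rewrite !inE; apply/imsetP/andP.
  move=> [A' ]; rewrite inE => /andP[BA /eqP <-] ->; rewrite cardsDS // eqxx.
  by rewrite setDE subsetIr.
move=> [AB /eqP cA]; exists (A :|: B); last first.
  by rewrite setDUl setDv setU0; apply/esym/setDidPl; rewrite disjoints_subset.
rewrite inE subsetUr cardsU cA.
have -> : A :&: B = set0 by apply/eqP; rewrite setI_eq0 disjoints_subset.
by rewrite cards0 subn0 subnK ?eqxx.
Qed.

(* A point of {0,1}^r is encoded by its support A, and a multilinear monomial by
   the set B of its variables, so that its value at A is (B \subset A)%:R. *)
Section Layers.
Variables (R : realFieldType) (r : nat).
Implicit Types (A B : {set 'I_r}) (t k : nat).

Definition layer t A : R := (#|A| == t)%:R / 'C(r, t)%:R.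

Lemma layer_ge0 t A : 0 <= layer t A.
Proof. by rewrite divr_ge0. Qed.

(** At [t <= r] this is the probability that a uniform [t]-subset of ['I_r] contains a fixed
    [b]-subset. *)
Definition ffact_poly b : {poly R} :=
  (r ^_ b)%:R^-1 *: \prod_(i < b) ('X - i%:R%:P).

Lemma size_ffact_poly b : (size (ffact_poly b) <= b.+1)%N.
Proof.
apply: leq_trans (size_scale_leq _ _) _.
by rewrite size_prod_XsubC -[index_enum _]enumT size_enum_ord.
Qed.

Lemma horner_ffact_poly b t : (ffact_poly b).[t%:R] = (t ^_ b)%:R / (r ^_ b)%:R.
Proof.
rewrite hornerZ mulrC; congr (_ / _); rewrite horner_prod ffact_prod natr_prod.
have [bt|tb] := leqP b t.
  apply: eq_bigr => i _; rewrite hornerXsubC natrB //.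
  by rewrite ltnW // (leq_trans (ltn_ord i)).
(* For [t < b] both products vanish through their factor at index [t]. *)
rewrite (bigD1 (Ordinal tb)) //= hornerXsubC subrr mul0r.
by rewrite (bigD1 (Ordinal tb)) //= subnn mul0r.
Qed.

(* The average of a monomial over a layer is a polynomial in the layer's index,
   of the same degree: Minsky--Papert symmetrization. *)
Lemma sum_layer_supset t B : (t <= r)%N ->
  \sum_A layer t A * (B \subset A)%:R = (ffact_poly #|B|).[t%:R].
Proof.
move=> tr; rewrite horner_ffact_poly /layer.
under eq_bigr do rewrite mulrAC -natrM mulnb.
rewrite -mulr_suml -natr_sum.
have -> : (\sum_(A : {set 'I_r}) ((#|A| == t) && (B \subset A)) =
    #|[set A : {set 'I_r} | (B \subset A) && (#|A| == t)]|)%N.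
  rewrite -sum1_card [RHS]big_mkcond /=; apply: eq_bigr => A _.
  by rewrite inE andbC; case: ifP.
have Br : (#|B| <= r)%N by rewrite -[r in (_ <= r)%N]card_ord max_card.
have C0 : 'C(r, t)%:R != 0 :> R by rewrite pnatr_eq0 -lt0n bin_gt0.
have f0 : (r ^_ #|B|)%:R != 0 :> R by rewrite pnatr_eq0 -lt0n ffact_gt0.
have [Bt|tB] := leqP #|B| t; last first.
  rewrite ffact_small // mul0r eq_card0 ?mul0r // => A; rewrite inE.
  apply/negP => /andP[/subset_leq_card + /eqP At].
  by rewrite At leqNgt tB.
rewrite card_supset_draws // card_ord; apply/eqP.
by rewrite eqr_div // -!natrM eqr_nat mulnC [eqbRHS]mulnC bin_ffact_sub // Bt.
Qed.

Lemma layer0 t : layer t set0 = (t == 0)%:R.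
Proof.
by rewrite /layer cards0 eq_sym; case: t => [|t]; rewrite ?bin0 ?divr1 // mul0r.
Qed.

Lemma expn2_gt1 : (0 < r)%N -> (1 < 2 ^ r)%N.
Proof. by move=> r0; rewrite -[X in (X < _)%N](expn0 2) ltn_exp2l. Qed.

Definition unif_nonempty A : R := (A != set0)%:R / (2 ^ r).-1%:R.

Lemma sum_unif_nonempty : (0 < r)%N -> \sum_A unif_nonempty A = 1.
Proof.
move=> r0; rewrite -mulr_suml -natr_sum.
have -> : (\sum_(A : {set 'I_r}) (A != set0) = (2 ^ r).-1)%N.
  rewrite -[in RHS](card_ord r) -[in RHS](cardsT 'I_r) -card_powerset.
  rewrite powersetT cardsT -(cardC1 (set0 : {set 'I_r})) -sum1_card.
  by rewrite [RHS]big_mkcond; apply: eq_bigr => A _; rewrite inE; case: ifP.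
rewrite divff // pnatr_eq0; have := expn2_gt1 r0; lia.
Qed.

Lemma unif_nonempty_ge A : (0 < r)%N -> A != set0 ->
  (2 ^+ r)^-1 <= unif_nonempty A.
Proof.
move=> r0 A0; rewrite /unif_nonempty A0 mul1r -natrX.
rewrite lef_pV2 ?posrE ?ltr0n ?expn_gt0 //.
  by rewrite ler_nat leq_pred.
have := expn2_gt1 r0; lia.
Qed.

(** Adding the same uniform part to both sides preserves equality of moments, and 11/18 is 11/12
    times 2/3, still above 1/2. *)
Lemma or_block_dual k : (0 < r)%N -> (9 * k ^ 2 <= r)%N ->
  exists l0 l1 : {set 'I_r} -> R,
  [/\ \sum_A l0 A = 1, l1 set0 = 0, 11 / 18 <= l0 set0,
      forall A, A != set0 ->
        ((12 * 2 ^+ r)^-1 <= l0 A) && ((12 * 2 ^+ r)^-1 <= l1 A) &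
      forall B, (#|B| <= k)%N ->
        \sum_A l0 A * (B \subset A)%:R = \sum_A l1 A * (B \subset A)%:R].
Proof.
move=> r0 kr; have [a [b [ab0 a1 a_0 b_0 ab]]] := or_dual_weights R k.
(* Every node is a Hamming weight available in the cube: node 1 by [r0], the later ones by [kr]. *)
have nr (i : 'I_k.+2) : (node i <= r)%N.
  case: i => [[|[|j]] jk] //=; apply: leq_trans kr.
  by rewrite leq_mul2l leq_sqr.
pose mix (c : 'I_k.+2 -> R) A :=
  11 / 12 * \sum_i c i * layer (node i) A + 12^-1 * unif_nonempty A.
have mixE c B : \sum_A mix c A * (B \subset A)%:R =
    11 / 12 * \sum_i c i * (ffact_poly #|B|).[(node i)%:R]
    + 12^-1 * \sum_A unif_nonempty A * (B \subset A)%:R.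
  under eq_bigr do rewrite mulrDl -(mulrA (11 / 12)) -(mulrA 12^-1).
  rewrite big_split /= -!mulr_sumr; congr (_ * _ + _).
  under [LHS]eq_bigr do rewrite mulr_suml.
  rewrite exchange_big /=; apply: eq_bigr => i _.
  rewrite -(sum_layer_supset _ (nr i)) mulr_sumr.
  by apply: eq_bigr => A _; rewrite mulrA.
have mix_ge c A : (forall i, 0 <= c i) -> A != set0 ->
    (12 * 2 ^+ r)^-1 <= mix c A.
  move=> c0 A0; rewrite invfM /mix -[leLHS]add0r lerD //.
    rewrite mulr_ge0 ?divr_ge0 // sumr_ge0 // => i _.
    by rewrite mulr_ge0 ?layer_ge0.
  by rewrite ler_pM2l ?invr_gt0 // unif_nonempty_ge.
have mix0 c : mix c set0 = 11 / 12 * c ord0.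
  rewrite /mix /unif_nonempty eqxx mul0r mulr0 addr0 big_ord_recl big1.
    by rewrite layer0 mulr1 addr0.
  by move=> i _; rewrite layer0 (_ : _ == 0 = false) ?mulr0 //; case: i => -[].
exists (mix a), (mix b); split.
(* The total mass is the moment of the empty monomial. *)
- rewrite (eq_bigr (fun A => mix a A * (set0 \subset A)%:R)); last first.
    by move=> A _; rewrite sub0set mulr1.
  rewrite mixE cards0 (eq_bigr a); last first.
    by move=> i _; rewrite horner_ffact_poly !ffactn0 divr1 mulr1.
  rewrite a1 (eq_bigr unif_nonempty); last first.
    by move=> A _; rewrite sub0set mulr1.
  by rewrite sum_unif_nonempty //; field.
- by rewrite mix0 b_0 mulr0.
- by rewrite mix0; lra.
- by move=> A A0; rewrite !mix_ge // => i; have /andP[] := ab0 i.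
- move=> B Bk; rewrite !mixE ab //.
  by apply: leq_trans (size_ffact_poly _) _.
Qed.

End Layers.

(** * Products of blocks *)

Section Tensor.
Variables (R : realFieldType) (m r k : nat).
Variables (l0 l1 : {set 'I_r} -> R) (beta : R).
Hypothesis beta_gt0 : 0 < beta.
Hypothesis sum_l0 : \sum_A l0 A = 1.
Hypothesis l1_set0 : l1 set0 = 0.
Hypothesis l0_set0 : 1 + beta <= 2 * l0 set0.
Hypothesis l01_ge : forall A, A != set0 -> (beta <= l0 A) && (beta <= l1 A).
Hypothesis l01_dual : forall B : {set 'I_r}, (#|B| <= k)%N ->
  \sum_A l0 A * (B \subset A)%:R = \sum_A l1 A * (B \subset A)%:R.

Notation blocks := {ffun 'I_m -> {set 'I_r}}.
Implicit Types (F : blocks) (A : {set 'I_r}).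

Let l0_set0_le1 : l0 set0 <= 1.
Proof.
rewrite -sum_l0 (bigD1 set0) //= lerDl sumr_ge0 // => A /l01_ge/andP[lA _].
by apply: le_trans lA; apply: ltW.
Qed.

Let l0_ge A : beta <= l0 A.
Proof.
have [->|/l01_ge/andP[]//] := eqVneq A set0.
(* Since [l0 set0 <= 1] forces [beta <= 1], the lower bound [(1 + beta) / 2] is at least [beta]. *)
by have := l0_set0_le1; have := l0_set0; move: (l0 set0) => d; lra.
Qed.

Let l0_ge0 A : 0 <= l0 A.
Proof. by apply: le_trans (l0_ge A); apply: ltW. Qed.

Definition l0_balanced A : R := if A == set0 then l0 set0 - 1 else l0 A.

Definition mp_dual F : R :=
  \prod_i l1 (F i) - \prod_i l0 (F i) + \prod_i l0_balanced (F i).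

Definition all_nonempty F := [forall i, F i != set0].

Lemma mp_dual_nonempty F : all_nonempty F -> mp_dual F = \prod_i l1 (F i).
Proof.
move=> /forallP F0; rewrite /mp_dual.
rewrite [X in _ + X](_ : _ = \prod_i l0 (F i)) ?subrK //.
by apply: eq_bigr => i _; rewrite /l0_balanced (negPf (F0 i)).
Qed.

Lemma mp_dual_ge F : all_nonempty F -> beta ^+ m <= mp_dual F.
Proof.
move=> F0; rewrite mp_dual_nonempty // -[in beta ^+ m](card_ord m) -prodr_const.
apply: ler_prod => i _; rewrite (ltW beta_gt0) /=.
by have /andP[] := l01_ge (forallP F0 i).
Qed.

(** With [P], [Q] the products over the blocks other than an empty one, the value is
    [- l0 set0 * P - (1 - l0 set0) * Q]. As [|Q| <= P], it is at most [- (2 * l0 set0 - 1) * P],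
    hence at most [- beta * P]. *)
Lemma mp_dual_le F : ~~ all_nonempty F -> mp_dual F <= - beta ^+ m.
Proof.
rewrite negb_forall => /existsP[i]; rewrite negbK => /eqP Fi.
rewrite /mp_dual (bigD1 i) //= Fi l1_set0 mul0r sub0r lerNr opprD opprK.
rewrite !(bigD1 i (P := predT)) //= Fi.
have -> : l0_balanced set0 = l0 set0 - 1 by rewrite /l0_balanced eqxx.
set P := \prod_(_ | _) l0 _; set Q := \prod_(_ | _) l0_balanced _.
have PQ : `|Q| <= P.
  rewrite normr_prod; apply: ler_prod => j _; rewrite normr_ge0 /= /l0_balanced.
  case: eqP => [->|_]; last by rewrite ger0_norm.
  rewrite ler_norml; move: l0_set0 l0_set0_le1 beta_gt0.
  move: (l0 set0) => d d1 d2 b0.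
  by apply/andP; split; move: d1 d2 b0; lra.
have bP : beta ^+ m.-1 <= P.
  rewrite -[m in m.-1]card_ord -(cardC1 i) -prodr_const.
  by apply: ler_prod => j _; rewrite (ltW beta_gt0) l0_ge.
have m0 : (0 < m)%N by apply: leq_ltn_trans (ltn_ord i).
rewrite -(prednK m0) exprS.
have : 0 < beta ^+ m.-1 by rewrite exprn_gt0.
move: PQ; rewrite ler_norml => /andP[].
move: l0_set0 l0_set0_le1 beta_gt0.
move: (l0 set0) (beta ^+ m.-1) bP => d t; nra.
Qed.

Lemma sum_prod_blocks (g : 'I_m -> {set 'I_r} -> R) :
  \sum_(F : blocks) \prod_i g i (F i) = \prod_i \sum_A g i A.
Proof. by rewrite bigA_distr_bigA. Qed.

(** The sums factor over blocks. [B i0 = set0] says that the monomial omits block [i0], where the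
    balanced factor sums to 0. *)
Lemma mp_dual_orth (B : 'I_m -> {set 'I_r}) i0 :
  (forall i, (#|B i| <= k)%N) -> B i0 = set0 ->
  \sum_F mp_dual F * \prod_i (B i \subset F i)%:R = 0.
Proof.
move=> Bk B0; rewrite /mp_dual.
under eq_bigr do rewrite mulrDl mulrBl -!big_split.
pose g (l : {set 'I_r} -> R) i A := l A * (B i \subset A)%:R.
rewrite big_split sumrB /= (sum_prod_blocks (g l1)) (sum_prod_blocks (g l0)).
rewrite (sum_prod_blocks (g l0_balanced)) {}/g.
rewrite [X in _ + X](bigD1 i0) //= B0 [X in _ + X * _](_ : _ = 0); last first.
  rewrite (bigD1 set0) //= /l0_balanced eqxx sub0set mulr1.
  rewrite (eq_bigr l0); last first.
    by move=> A /negPf ->; rewrite sub0set mulr1.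
  by rewrite addrAC -(bigD1 set0 (P := predT)) //= sum_l0 subrr.
rewrite mul0r addr0; apply/eqP; rewrite subr_eq0; apply/eqP.
by apply: eq_bigr => i _; rewrite l01_dual.
Qed.

(** The signed total is 0 by orthogonality to constants, and the positive part has the mass 1 of the
    product of the [l1]; so the negative part has mass 1 too. *)
Lemma sum_mp_dual_norm : (0 < m)%N -> \sum_F `|mp_dual F| = 2.
Proof.
move=> m0.
have S0 : \sum_F mp_dual F = 0.
  have := @mp_dual_orth (fun=> set0) (Ordinal m0).
  rewrite cards0 => /(_ (fun=> leq0n k) erefl) E.
  rewrite -[RHS]E; apply: eq_bigr => F _.
  by rewrite big1 ?mulr1 // => i _; rewrite sub0set.
have S1 : \sum_(F | all_nonempty F) mp_dual F = 1.
  rewrite (eq_bigr _ mp_dual_nonempty).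
  have E : \sum_(F : blocks) \prod_i l1 (F i) = 1.
    rewrite (sum_prod_blocks (fun=> l1)) big1 // => i _.
    have := @l01_dual set0; rewrite cards0 => /(_ (leq0n k)).
    under eq_bigr do rewrite sub0set mulr1.
    under [in RHS]eq_bigr do rewrite sub0set mulr1.
    by rewrite sum_l0.
  rewrite -[RHS]E [RHS](bigID all_nonempty) /= [X in _ + X]big1 ?addr0 // => F.
  rewrite negb_forall => /existsP[i]; rewrite negbK => /eqP Fi.
  by rewrite (bigD1 i) //= Fi l1_set0 mul0r.
rewrite (bigID all_nonempty) /= in S0.
rewrite (bigID all_nonempty) /= (eq_bigr mp_dual) => [|F F0]; last first.
  by rewrite ger0_norm // (le_trans _ (mp_dual_ge F0)) // exprn_ge0 // ltW.
rewrite [X in _ + X](eq_bigr (fun F => - mp_dual F)) => [|F F0]; last first.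
  rewrite ler0_norm // (le_trans (mp_dual_le F0)) //.
  by rewrite oppr_le0 exprn_ge0 // ltW.
by rewrite sumrN; lra.
Qed.

End Tensor.

(** * The cube *)

(* Imported only here because [classical_sets] shadows names of [finset]. *)
From mathcomp Require Import boolp classical_sets reals ereal.
From mathcomp Require Import -(notations) mpoly.

Section Cube.
Variables (R : realType) (m r : nat).
Notation blocks := {ffun 'I_m -> {set 'I_r}}.

Definition blocks_vec (F : blocks) : 'rV[R]_(m * r) :=
  map_mx (fun b : bool => b%:R) (mxvec (\matrix_(i, j) (j \in F i))).

Lemma blocks_vecE F i j : blocks_vec F 0 (mxvec_index i j) = (j \in F i)%:R.
Proof. by rewrite mxE mxvecE mxE. Qed.

Lemma blocks_vec_cube F : blocks_vec F \in cube R (m * r).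
Proof. by apply/imfsetP; exists (mxvec (\matrix_(i, j) (j \in F i))). Qed.

Definition cube_of_blocks F : cube R (m * r) := [` blocks_vec_cube F]%fset.

Definition blocks_of_cube (x : cube R (m * r)) : blocks :=
  [ffun i => [set j | (val x : 'rV[R]_(m * r)) 0 (mxvec_index i j) == 1]]%SET.

Lemma cube_of_blocksK : cancel cube_of_blocks blocks_of_cube.
Proof.
move=> F; apply/ffunP => i; apply/setP => j; rewrite ffunE inE blocks_vecE.
by rewrite pnatr_eq1 eqb1.
Qed.

Lemma blocks_of_cubeK : cancel blocks_of_cube cube_of_blocks.
Proof.
move=> x; apply/val_inj/rowP => k; case/mxvec_indexP: k => i j.
rewrite blocks_vecE ffunE inE; case/imfsetP: (valP x) => v _ /= ->.
rewrite mxE; case: (v _ _); first by rewrite eqxx.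
by rewrite eq_sym oner_eq0.
Qed.

Lemma MP_cube_of_blocks F : MP (cube_of_blocks F) = all_nonempty F.
Proof.
apply: eq_forallb => i; apply/existsP/set0Pn => -[j].
  by rewrite blocks_vecE pnatr_eq1 eqb1 => jF; exists j.
by move=> jF; exists j; rewrite blocks_vecE jF.
Qed.

Lemma card_cube : #|` cube R (m * r)| = (2 ^ (m * r))%N.
Proof.
rewrite cardfE -(bij_eq_card (Bijective cube_of_blocksK blocks_of_cubeK)).
rewrite card_ffun card_ord -cardsT -powersetT card_powerset cardsT.
by rewrite card_ord -expnM mulnC.
Qed.

Lemma sum_cube (G : cube R (m * r) -> R) :
  \sum_x G x = \sum_F G (cube_of_blocks F).
Proof.
rewrite (reindex cube_of_blocks) //=.
by exists blocks_of_cube => x _; rewrite ?cube_of_blocksK ?blocks_of_cubeK.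
Qed.

(** Exponents are forgotten, since positive powers of a 0/1 value are that value. *)
Definition mnm_block (u : multinom (m * r)) (i : 'I_m) : {set 'I_r} :=
  [set j | u (mxvec_index i j) != 0%N]%SET.

Lemma big_mxvec_index (T : Type) (idx : T) (op : Monoid.com_law idx)
    (G : 'I_(m * r) -> T) :
  \big[op/idx]_l G l = \big[op/idx]_i \big[op/idx]_j G (mxvec_index i j).
Proof.
rewrite pair_bigA /= (reindex (uncurry (@mxvec_index m r))) /=; last first.
  exact: curry_mxvec_bij.
by apply: eq_bigr => -[].
Qed.

Lemma sum_card_mnm_block (u : multinom (m * r)) :
  (\sum_i #|mnm_block u i| <= mdeg u)%N.
Proof.
rewrite mdegE big_mxvec_index; apply: leq_sum => i _.
rewrite -sum1_card big_mkcond; apply: leq_sum => j _.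
by rewrite inE; case: ifP; rewrite // lt0n.
Qed.

Lemma mnm_cube_of_blocks (u : multinom (m * r)) F :
  \prod_l (val (cube_of_blocks F) : 'rV[R]_(m * r)) 0 l ^+ u l =
  \prod_i (mnm_block u i \subset F i)%:R.
Proof.
rewrite big_mxvec_index; apply: eq_bigr => i _.
under eq_bigr do rewrite blocks_vecE.
have [/fintype.subsetP sF|/fintype.subsetPn[j]] := boolP (_ \subset _).
  apply: big1 => j _; case: (eqVneq (u (mxvec_index i j)) 0%N) => [->//|uj].
  by rewrite sF ?inE // expr1n.
rewrite inE => uj /negPf jF; rewrite (bigD1 j) //= jF expr0n (negPf uj).
by rewrite mul0r.
Qed.

Lemma pairing_cube_eq0 (G : cube R (m * r) -> R) (d : nat) :
  (forall B : 'I_m -> {set 'I_r}, (\sum_i #|B i| <= d)%N ->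
     \sum_F G (cube_of_blocks F) * \prod_i (B i \subset F i)%:R = 0) ->
  forall p, (tdeg p <= d)%N -> pairing G p = 0.
Proof.
move=> GB p pd; rewrite /pairing sum_cube.
under eq_bigr do rewrite /peval mevalE mulr_sumr.
rewrite exchange_big /= big_seq big1 // => u up.
under eq_bigr do rewrite mnm_cube_of_blocks mulrCA.
rewrite -mulr_sumr GB ?mulr0 //; apply: leq_trans (sum_card_mnm_block u) _.
(* The strict bound of [mdeg u] by [mmeasure mdeg p] offsets the predecessor in [tdeg]. *)
apply: leq_trans pd; have := mmeasure_mnm_lt mdeg up.
by rewrite /tdeg; case: (mmeasure _ p).
Qed.

End Cube.

(** * Smoothness and orthogonality of the distribution [|Phi| / 2] *)

Theorem theorem5p1 (R : realType) :
  exists c : R, 0 < c < 1 /\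
    forall m r : nat, (0 < m)%N -> (0 < r)%N ->
      ((Num.min m%:R (c * Num.sqrt r%:R))%:E
         <= smooth_thr_deg (@MP R m r) (12%:R ^- m.+1))%E.
Proof.
exists (3^-1); split; first by apply/andP; split; lra.
move=> m r m0 r0.
(* [k] is the integer part of [sqrt r / 3], whence the constant 1/3. *)
have [k kr kmax] : exists2 k, (9 * k ^ 2 <= r)%N & (r < 9 * k.+1 ^ 2)%N.
  have ex : exists k, (9 * k ^ 2 <= r)%N by exists 0%N.
  have ub k : (9 * k ^ 2 <= r -> k <= r)%N by nia.
  case: (ex_maxnP ex ub) => k kr kmax; exists k => //.
  by rewrite ltnNge; apply/negP => /kmax; rewrite ltnn.
have [l0 [l1 [sum_l0 l1_0 l0_0 l01_ge l01_dual]]] := or_block_dual R r0 kr.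
pose beta : R := (12 * 2 ^+ r)^-1.
have p1 : 1 <= 2 ^+ r :> R by rewrite exprn_ege1 // ler1n.
have beta0 : 0 < beta by rewrite invr_gt0; lra.
have beta12 : beta <= 12^-1.
  by rewrite lef_pV2 ?posrE; lra.
(* Twice 11/18 exceeds 1 by 2/9, which leaves room for [beta <= 1/12]. *)
have l0_0' : 1 + beta <= 2 * l0 finset.set0.
  by move: l0_0; move: (l0 _) => d; lra.
pose Phi := mp_dual (m := m) l0 l1.
pose mu (x : cube R (m * r)) := `|Phi (blocks_of_cube x)| / 2.
(* [Phi] is positive exactly where [MP] is true, so its sign is opposite to that of [(-1) ^+ MP]. *)
have sgn F : (-1) ^+ MP (cube_of_blocks R F) * mu (cube_of_blocks R F) =
    - Phi F / 2.
  rewrite MP_cube_of_blocks /mu cube_of_blocksK mulrA; congr (_ / _).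
  have bm : 0 <= beta ^+ m by rewrite exprn_ge0 // ltW.
  case: (boolP (all_nonempty F)) => F0.
    rewrite expr1 mulN1r ger0_norm //; apply: le_trans bm _.
    exact: (mp_dual_ge beta0 _ F0).
  rewrite expr0 mul1r ler0_norm //.
  apply: le_trans (mp_dual_le beta0 sum_l0 l1_0 l0_0' l01_ge F0) _.
  by rewrite oppr_le0.
have muP : smooth_distr (12%:R ^- m.+1) mu.
  split.
  - by move=> x; rewrite divr_ge0.
  - rewrite sum_cube; under eq_bigr do rewrite /mu cube_of_blocksK.
    rewrite -mulr_suml.
    rewrite (sum_mp_dual_norm beta0 sum_l0 l1_0 l0_0' l01_ge l01_dual m0).
    by rewrite divff // pnatr_eq0.
  - move=> x; rewrite card_cube.
    have : beta ^+ m <= `|Phi (blocks_of_cube x)|.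
      case: (boolP (all_nonempty (blocks_of_cube x))) => F0.
        apply: le_trans (ler_norm _); exact: (mp_dual_ge beta0 _ F0).
      rewrite -normrN; apply: le_trans (ler_norm _); rewrite lerNr.
      exact: (mp_dual_le beta0 sum_l0 l1_0 l0_0' l01_ge F0).
    rewrite /mu; move: `|_| => N bN.
    (* [beta ^+ m] already contains the cube's cardinality; the extra factor 12 in the smoothness
       absorbs the division of [|Phi|] by 2. *)
    have -> : 12%:R ^- m.+1 / (2 ^ (m * r))%:R = beta ^+ m / 12.
      rewrite /beta exprVn exprMn natrX mulnC exprM exprSr !invfM.
      exact: mulrAC.
    have : 0 < beta ^+ m by rewrite exprn_gt0.
    by move: (beta ^+ m) bN => t; lra.
have orthP p : pairing (fun x => (-1) ^+ MP x * mu x) p != 0 ->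
    Num.min m%:R (3^-1 * Num.sqrt r%:R) <= (tdeg p)%:R :> R.
  apply: contraR; rewrite -ltNge lt_min ltr_nat => /andP[pm pr].
  (* From [tdeg p < sqrt r / 3] follows [9 * tdeg p ^ 2 <= r < 9 * (k + 1) ^ 2]. *)
  have pk : (tdeg p <= k)%N.
    rewrite -ltnS -(ltn_sqr _ k.+1) -(ltn_pmul2l (m := 9)) //.
    apply: leq_ltn_trans kmax; rewrite -(ler_nat R).
    rewrite natrM natrX -[leRHS]sqr_sqrtr ?ler0n //.
    have -> : 9 * (tdeg p)%:R ^+ 2 = (3 * (tdeg p)%:R) ^+ 2 :> R by ring.
    rewrite ler_sqr ?nnegrE ?sqrtr_ge0 ?mulr_ge0 //.
    by move: pr; move: (Num.sqrt _) => s; lra.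
  apply/eqP; apply: pairing_cube_eq0 (leqnn _) => B sB.
  have BK i : (#|B i| <= k)%N.
    by apply: leq_trans pk; apply: leq_trans sB; rewrite (bigD1 i) //= leq_addr.
  (* Pigeonhole: [m] nonempty sets would have total size at least [m], above [tdeg p]. *)
  have [i Bi] : exists i, B i = finset.set0.
    apply: contrapT => /forallNP nB; move: (leq_ltn_trans sB pm).
    rewrite ltnNge => /negP; apply; rewrite -[leqLHS]card_ord -sum1_card.
    by apply: leq_sum => i _; rewrite card_gt0; apply/eqP/nB.
  under eq_bigr do rewrite sgn mulrAC mulNr -mulNr.
  rewrite -mulr_suml; under eq_bigr do rewrite mulNr.
  by rewrite sumrN (mp_dual_orth sum_l0 l01_dual BK Bi) oppr0 mul0r.
apply: (@le_trans _ _ (orth (fun x : cube R (m * r) => (-1) ^+ MP x * mu x))).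
  2: by apply: ereal_sup_ubound; exists mu.
apply: le_ereal_inf_tmp => _ [p np <-]; rewrite lee_fin.
exact: orthP.
Qed.
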